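(* Let $F$ be any field, and let $F(x)$ be the field of rational functions in $x$ over $F$. Let $G$ be any finite subgroup of $PGL(2,F)$, and let $F(x)^G$ be the field of $G$-invariant rational functions. Let $f(x)/g(x)$, with $f,g\in F[x]$ relatively prime, be a generator of $F(x)^G$ over $F$. Then $f(T)-xg(T)\in F(x)[T]$ is irreducible of degree $|G|$ (in $T$) and has Galois group $G$ over $F(x)$.
   Context: $PGL(2,F)$ is the group of $F$-automorphisms of $F(x)$: the element represented by the linear fractional transformation $s(x)=\frac{ax+b}{cx+d}$ ($a,b,c,d\in F$, $ad-bc\neq 0$) sends $r(x)$ to $r(s(x))$. $F(x)^G$ is the subfield of elements fixed by all of $G$. A generator of $F(x)^G$ is an element $\Phi(x)\in F(x)$ with $F(x)^G=F(\Phi(x))$. *)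

(* Defs.v *)
From HB Require Import structures.
From mathcomp Require Import all_boot all_order all_algebra all_fingroup all_field.
From mathcomp Require Import finmap generic_quotient.

Set Implicit Arguments.
Unset Strict Implicit.
Unset Printing Implicit Defensive.

Import GRing.Theory.
Local Open Scope ring_scope.
Local Open Scope quotient_scope.

Section ProjectiveLinearGroup.
Variable F : fieldType.

Definition GL2 := {A : 'M[F]_2 | A \in unitmx}.

Implicit Types A B C : GL2.

Definition GL2_one : GL2 := Sub 1%:M (unitmx1 F 2).

Fact GL2_mul_subproof A B : val A *m val B \in unitmx.
Proof. by rewrite unitmx_mul (valP A) (valP B). Qed.
Definition GL2_mul A B : GL2 := Sub (val A *m val B) (GL2_mul_subproof A B).

Fact GL2_inv_subproof A : invmx (val A) \in unitmx.
Proof. by rewrite unitmx_inv (valP A). Qed.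
Definition GL2_inv A : GL2 := Sub (invmx (val A)) (GL2_inv_subproof A).

Definition scalar_equiv A B := is_scalar_mx (val A *m invmx (val B)).

Lemma scalar_equivP A B :
  reflect (exists2 c : F, c != 0 & val A = c *: val B) (scalar_equiv A B).
Proof.
apply: (iffP is_scalar_mxP) => [[c AB]|[c c0 AB]].
  have AcB : val A = c *: val B.
    by rewrite -mul_scalar_mx -AB mulmxKV ?(valP B).
  exists c => //; apply: contraTneq (valP A) => c0.
  by rewrite AcB c0 scale0r unitmxE det0 unitr0.
by exists c; rewrite AB -scalemxAl mulmxV ?(valP B) // scalemx1.
Qed.

Lemma scalar_equiv_refl : reflexive scalar_equiv.
Proof. by move=> A; apply/scalar_equivP; exists 1; rewrite ?oner_eq0 ?scale1r. Qed.

Lemma scalar_equiv_sym : symmetric scalar_equiv.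
Proof.
have H A B : scalar_equiv A B -> scalar_equiv B A.
  case/scalar_equivP=> c c0 AB; apply/scalar_equivP; exists c^-1.
    by rewrite invr_eq0.
  by rewrite AB scalerA mulVf ?scale1r.
by move=> A B; apply/idP/idP; apply: H.
Qed.

Lemma scalar_equiv_trans : transitive scalar_equiv.
Proof.
move=> B A C /scalar_equivP[c c0 AB] /scalar_equivP[d d0 BC].
by apply/scalar_equivP; exists (c * d); rewrite ?mulf_neq0 // AB BC scalerA.
Qed.

Canonical scalar_equiv_equiv :=
  EquivRel scalar_equiv scalar_equiv_refl scalar_equiv_sym scalar_equiv_trans.

Definition PGL2 := {eq_quot scalar_equiv}.
HB.instance Definition _ : EqQuotient _ scalar_equiv PGL2 := EqQuotient.on PGL2.
HB.instance Definition _ := Choice.on PGL2.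

Lemma PGL2_reprP A :
  exists2 c : F, c != 0 & val (repr (\pi_PGL2 A)) = c *: val A.
Proof. by apply/scalar_equivP; rewrite -eqmodE reprK. Qed.

Definition PGL2_one : PGL2 := \pi GL2_one.
Definition PGL2_mul := lift_op2 PGL2 GL2_mul.
Definition PGL2_inv := lift_op1 PGL2 GL2_inv.

Lemma pi_PGL2_mul : {morph \pi_PGL2 : A B / GL2_mul A B >-> PGL2_mul A B}.
Proof.
move=> A B; unlock PGL2_mul; apply/eqmodP; rewrite /= scalar_equiv_sym.
have [c c0 cA] := PGL2_reprP A; have [d d0 dB] := PGL2_reprP B.
apply/scalar_equivP; exists (c * d); rewrite ?mulf_neq0 //=.
by rewrite cA dB -scalemxAl -scalemxAr scalerA.
Qed.

Lemma pi_PGL2_inv : {morph \pi_PGL2 : A / GL2_inv A >-> PGL2_inv A}.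
Proof.
move=> A; unlock PGL2_inv; apply/eqmodP; rewrite /= scalar_equiv_sym.
have [c c0 cA] := PGL2_reprP A.
apply/scalar_equivP; exists c^-1; rewrite ?invr_eq0 //= cA invmxZ //.
by rewrite -cA; exact: valP.
Qed.

Lemma PGL2_mulA : associative PGL2_mul.
Proof.
elim/quotW=> A; elim/quotW=> B; elim/quotW=> C; rewrite -!pi_PGL2_mul.
by congr (\pi _); apply: val_inj; rewrite /= mulmxA.
Qed.

Lemma PGL2_mul1 : left_id PGL2_one PGL2_mul.
Proof.
elim/quotW=> A; rewrite -pi_PGL2_mul.
by congr (\pi _); apply: val_inj; rewrite /= mul1mx.
Qed.

Lemma PGL2_1mul : right_id PGL2_one PGL2_mul.
Proof.
elim/quotW=> A; rewrite -pi_PGL2_mul.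
by congr (\pi _); apply: val_inj; rewrite /= mulmx1.
Qed.

Lemma PGL2_mulV : left_inverse PGL2_one PGL2_inv PGL2_mul.
Proof.
elim/quotW=> A; rewrite -pi_PGL2_inv -pi_PGL2_mul.
by congr (\pi _); apply: val_inj; rewrite /= mulVmx ?(valP A).
Qed.

Lemma PGL2_Vmul : right_inverse PGL2_one PGL2_inv PGL2_mul.
Proof.
elim/quotW=> A; rewrite -pi_PGL2_inv -pi_PGL2_mul.
by congr (\pi _); apply: val_inj; rewrite /= mulmxV ?(valP A).
Qed.

HB.instance Definition _ := isGroup.Build PGL2
  PGL2_mulA PGL2_mul1 PGL2_1mul PGL2_mulV PGL2_Vmul.

End ProjectiveLinearGroup.

Section RationalFunctions.
Variable F : fieldType.

Definition ratfun := {fraction {poly F}}.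

Definition ratfunC : F -> ratfun := @FracField.tofrac {poly F} \o polyC.
Definition ratfunX : ratfun := @FracField.tofrac {poly F} 'X.

HB.instance Definition _ := GRing.RMorphism.on ratfunC.

Definition poly_at (p : {poly F}) (s : ratfun) : ratfun := (map_poly ratfunC p).[s].

(* r(s(x)), computed on a chosen representative n/d of r.  This does not depend
   on the representative as long as s is transcendental over F, which is the
   case for every linear fractional transformation s. *)
Definition ratfun_comp (r s : ratfun) : ratfun :=
  poly_at \n_(repr r) s / poly_at \d_(repr r) s.

Definition lin_frac (A : 'M[F]_2) : ratfun :=
  (ratfunC (A 0 0) * ratfunX + ratfunC (A 0 1)) /
  (ratfunC (A 1 0) * ratfunX + ratfunC (A 1 1)).

(* r(x) |-> r(s(x)); this is a right action, in accordance with the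
   composition order of 'Gal(_ / _). *)
Definition pgl_act (s : PGL2 F) (r : ratfun) : ratfun :=
  ratfun_comp r (lin_frac (val (repr s))).

Lemma lin_fracZ c A : c != 0 -> lin_frac (c *: A) = lin_frac A.
Proof.
move=> c0; rewrite /lin_frac !mxE !rmorphM -!mulrA -!mulrDr.
by rewrite -mulf_div divff ?mul1r // fmorph_eq0.
Qed.

Lemma pgl_act_pi (A : GL2 F) r :
  pgl_act (\pi_(PGL2 F) A) r = ratfun_comp r (lin_frac (val A)).
Proof. by rewrite /pgl_act; have [c c0 ->] := PGL2_reprP A; rewrite lin_fracZ. Qed.

(* Membership in F(x)^G. *)
Definition invariant (G : {fset PGL2 F}) (r : ratfun) : Prop :=
  {in G, forall s, pgl_act s r = r}.

(* Membership in F(phi). *)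
Definition in_adjoin (phi r : ratfun) : Prop :=
  exists p q : {poly F}, poly_at q phi != 0 /\ r = poly_at p phi / poly_at q phi.

Definition is_generator (G : {fset PGL2 F}) (phi : ratfun) : Prop :=
  forall r : ratfun, invariant G r <-> in_adjoin phi r.

(* f(T) - x g(T) *)
Definition generic_poly (f g : {poly F}) : {poly ratfun} :=
  map_poly ratfunC f - ratfunX *: map_poly ratfunC g.

End RationalFunctions.

(* The finite group A is isomorphic to the finite subgroup G of H. *)
Definition isog_fset (gT : finGroupType) (A : {group gT})
    (H : groupType) (G : {fset H}) : Prop :=
  exists phi : gT -> H,
    [/\ {in A &, {morph phi : x y / (x * y)%g}},
        {in A &, injective phi}
      & forall h : H, h \in G <-> exists2 x, x \in A & phi x = h].

(* The existence clause prevents the second one, which quantifies over all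
   splitting fields, from holding vacuously. *)
Definition has_galois_group (K : fieldType) (p : {poly K})
    (H : groupType) (G : {fset H}) : Prop :=
  (exists L : splittingFieldType K,
     splittingFieldFor 1 (map_poly (in_alg L) p) {:L}) /\
  (forall L : splittingFieldType K,
     splittingFieldFor 1 (map_poly (in_alg L) p) {:L} ->
     galois 1 {:L} /\ isog_fset 'Gal({:L} / 1) G).

(* Main.v *)
Require Import Defs.
From HB Require Import structures.
From mathcomp Require Import all_boot all_order all_algebra all_fingroup all_field.
From mathcomp Require Import finmap generic_quotient ring.

Set Implicit Arguments.
Unset Strict Implicit.
Unset Printing Implicit Defensive.

Import GRing.Theory.
Local Open Scope ring_scope.

Local Notation tofrac := (@FracField.tofrac _).

(** Write phi for f/g.  Substituting phi for x is an embedding sigma of F(x)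
into itself whose image is F(phi), the field of invariants of G.  It carries
P = f(T) - x g(T) to f(T) - phi g(T), whose roots are visible inside F(x): since
phi is invariant, s(x) is a root for every s in G, and these elements are
pairwise distinct.  Hence everything about P over F(x) can be read off from the
extension F(x) of F(phi).

The degree comes from two bounds.  The distinct roots s(x) give deg P >= |G|.
Conversely the product of the T - s(x) has invariant coefficients, so it is the
image under sigma of some polynomial over F(x), and P has the least degree among
the nonzero polynomials R such that sigma(R) vanishes at x ([generic_poly_min]).
That minimality is the rational root theorem read in F[T][x]: after clearing
denominators, f/g is a root of a polynomial in x over F[T], so that g, and f
unless it is 0, each divide a nonzero coefficient, while deg P is the larger of
the degrees of f and g.  Minimality also shows that P divides R exactly when sigma(R)
vanishes at x ([generic_poly_dvdp]), which yields irreducibility.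

For the Galois group, let z be a root of P in an extension L of F(x).  Because
P divides whatever vanishes at z, the element z is transcendental over F, and
tau : r |-> r(z) embeds F(x) in L so that tau(sigma(r)) is the canonical image of
r in L.  So tau carries the
picture inside F(x) to L: the roots of P in L are the tau(s(x)), they are
distinct, and they all lie in F(x)(z).  A splitting field is therefore
F(x)(z) = tau(F(x)), it is Galois, and an automorphism h is determined by the
unique s in G with h(z) = tau(s(x)); then h o tau is tau after the action of s,
which makes h |-> s a morphism, and it is onto because P is irreducible. *)

(** * Substitution in rational functions *)

Lemma ratfun_numden (F : fieldType) (r : ratfun F) :
  r = tofrac \n_(repr r) / tofrac \d_(repr r).
Proof.
have d0 : tofrac \d_(repr r) != 0 by rewrite tofrac_eq0 denom_ratioP.
apply: (canRL (mulfK d0)).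
have pi_mul (x : {ratio {poly F}}) :
    (\pi x : ratfun F)%qT * tofrac \d_x = tofrac \n_x.
  rewrite !piE; apply/eqmodP; rewrite /= FracField.equivfE /FracField.mulf.
  by rewrite !numden_Ratio ?mulr1 ?oner_eq0 ?denom_ratioP // mulrC.
by rewrite -pi_mul reprK.
Qed.

Lemma ratfun_fracP (F : fieldType) (r : ratfun F) :
  exists n, exists2 d, d != 0 & r = tofrac n / tofrac d.
Proof.
by exists \n_(repr r), \d_(repr r); [exact: denom_ratioP | exact: ratfun_numden].
Qed.

Lemma tofrac_poly_at (F : fieldType) (p : {poly F}) :
  tofrac p = poly_at p (ratfunX F).
Proof.
rewrite -[p in LHS]comp_polyXr /comp_poly -horner_map /= -map_poly_comp.
by [].
Qed.

Section RatfunSubst.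
Variables (F E : fieldType) (i : {rmorphism F -> E}) (w : E).

(** The proof of transcendence is an argument so that the ring morphism
structure, which needs it, can be attached to the function. *)
Definition ratfun_subst (w_transc : ~ algebraicOver i w) (r : ratfun F) : E :=
  (map_poly i \n_(repr r)).[w] / (map_poly i \d_(repr r)).[w].

Hypothesis w_transc : ~ algebraicOver i w.

Lemma transc_horner_eq0 p : ((map_poly i p).[w] == 0) = (p == 0).
Proof.
apply/idP/eqP => [pw0|->]; last by rewrite rmorph0 horner0.
by apply: contra_not_eq w_transc => p0; exists p.
Qed.

Lemma ratfun_subst_frac n d : d != 0 ->
  ratfun_subst w_transc (tofrac n / tofrac d)
    = (map_poly i n).[w] / (map_poly i d).[w].
Proof.
move=> d0; rewrite /ratfun_subst; set r := tofrac n / _.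
have dr0 : \d_(repr r) != 0 by exact: denom_ratioP.
apply/eqP; rewrite eqr_div ?transc_horner_eq0 // -!hornerM -!rmorphM /=.
suff -> : \n_(repr r) * d = n * \d_(repr r) by [].
apply/eqP; rewrite -tofrac_eq !rmorphM /= -eqr_div ?tofrac_eq0 //.
by rewrite -ratfun_numden.
Qed.

Fact ratfun_subst_zmod_morphism : zmod_morphism (ratfun_subst w_transc).
Proof.
move=> r s; have [n [d d0 ->]] := ratfun_fracP r.
have [m [e e0 ->]] := ratfun_fracP s.
rewrite -mulNr addf_div ?tofrac_eq0 // mulNr -!rmorphM -rmorphB /=.
rewrite !ratfun_subst_frac ?mulf_neq0 // -[in RHS]mulNr.
rewrite addf_div ?transc_horner_eq0 //.
by rewrite rmorphB !rmorphM /= !hornerE mulNr.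
Qed.

Fact ratfun_subst_monoid_morphism : monoid_morphism (ratfun_subst w_transc).
Proof.
split.
  rewrite -[1]divr1 -tofrac1 ratfun_subst_frac ?oner_eq0 //.
  by rewrite rmorph1 hornerC divr1.
move=> r s; have [n [d d0 ->]] := ratfun_fracP r.
have [m [e e0 ->]] := ratfun_fracP s.
rewrite mulf_div -!rmorphM /= !ratfun_subst_frac ?mulf_neq0 //.
by rewrite mulf_div !rmorphM /= !hornerE.
Qed.

HB.instance Definition _ := GRing.isZmodMorphism.Build _ _
  (ratfun_subst w_transc) ratfun_subst_zmod_morphism.
HB.instance Definition _ := GRing.isMonoidMorphism.Build _ _
  (ratfun_subst w_transc) ratfun_subst_monoid_morphism.

Lemma ratfun_subst_tofrac p :
  ratfun_subst w_transc (tofrac p) = (map_poly i p).[w].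
Proof.
by rewrite -[tofrac p]divr1 -tofrac1 ratfun_subst_frac ?oner_eq0 //
  rmorph1 hornerC divr1.
Qed.

Lemma ratfun_substC c : ratfun_subst w_transc (ratfunC c) = i c.
Proof. by rewrite ratfun_subst_tofrac map_polyC hornerC. Qed.

Lemma ratfun_substX : ratfun_subst w_transc (ratfunX F) = w.
Proof. by rewrite ratfun_subst_tofrac map_polyX hornerX. Qed.

End RatfunSubst.

Lemma ratfun_rmorph_exists (F E : fieldType) (i : {rmorphism F -> E}) (w : E) :
  ~ algebraicOver i w ->
  exists2 u : {rmorphism ratfun F -> E},
    u \o @ratfunC F =1 i & u (ratfunX F) = w.
Proof.
move=> w_transc; exists (ratfun_subst w_transc).
  exact: (ratfun_substC w_transc).
exact: (ratfun_substX w_transc).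
Qed.

Lemma rmorph_tofrac (F E : fieldType) (u : {rmorphism ratfun F -> E}) p :
  u (tofrac p) = (map_poly (u \o @ratfunC F) p).[u (ratfunX F)].
Proof.
by rewrite tofrac_poly_at map_poly_comp horner_map.
Qed.

Lemma eq_ratfun_rmorph (F E : fieldType) (u v : {rmorphism ratfun F -> E}) :
  u \o @ratfunC F =1 v \o @ratfunC F -> u (ratfunX F) = v (ratfunX F) ->
  u =1 v.
Proof.
move=> uvC uvX r; have uv p : u (tofrac p) = v (tofrac p).
  by rewrite (rmorph_tofrac u) (rmorph_tofrac v) uvX (eq_map_poly uvC).
have [n [d _ ->]] := ratfun_fracP r.
by rewrite (fmorph_div u) (fmorph_div v) !uv.
Qed.

(** * Rational roots and transcendence of f/g *)

Lemma homogenized_root (F : fieldType) (f g : {poly F}) (B : {poly {poly F}}) n :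
  (size B <= n.+1)%N -> g != 0 ->
  root (map_poly tofrac B) (tofrac f / tofrac g) ->
  \sum_(j < n.+1) B`_j * f ^+ j * g ^+ (n - j) = 0.
Proof.
move=> leBn g0; have tg0 : tofrac g != 0 by rewrite tofrac_eq0.
have szB : (size (map_poly tofrac B) <= n.+1)%N.
  exact: leq_trans (size_poly _ _) leBn.
move=> /rootP; rewrite (horner_coef_wide _ szB) => B0.
apply/eqP; rewrite -tofrac_eq tofrac0 -(mulr0 (tofrac g ^+ n)) -B0.
rewrite rmorph_sum mulr_sumr; apply/eqP/eq_bigr => j _ /=.
have jn : (j <= n)%N by rewrite -ltnS.
have gn : tofrac g ^+ n = tofrac g ^+ (n - j) * tofrac g ^+ j.
  by rewrite -exprD subnK.
rewrite coef_map_id0 ?tofrac0 // !rmorphM !rmorphXn /= gn expr_div_n.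
by rewrite [RHS]mulrCA -[LHS]mulrA -[in RHS]mulrA (mulrC (_ ^+ j) (_ / _))
  divfK ?expf_neq0 // [X in _ = _ * X]mulrC.
Qed.

(** All terms of the homogenized equation but the leading one are divisible
by g, and g is coprime to the power of f in that term. *)
Lemma dvdp_lead_rational_root (F : fieldType) (f g : {poly F})
    (B : {poly {poly F}}) :
  g != 0 -> coprimep f g ->
  root (map_poly tofrac B) (tofrac f / tofrac g) -> g %| lead_coef B.
Proof.
move=> g0 cofg Broot; have [->|B0] := eqVneq B 0; first by rewrite lead_coef0.
have szB : (size B).-1.+1 = size B by rewrite prednK ?size_poly_gt0.
have := homogenized_root (eq_leq (esym szB)) g0 Broot.
rewrite big_ord_recr /= subnn mulr1 => /eqP; rewrite addrC addr_eq0 => /eqP E.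
rewrite -(Gauss_dvdpl _ (coprimep_expr (size B).-1 (_ : coprimep g f))).
  rewrite lead_coefE E dvdpNr; elim/big_ind: _ => [|p q|j _]; rewrite ?dvdp0 //.
    exact: dvdp_add.
  by rewrite dvdp_mull // dvdp_exp // subn_gt0.
by rewrite coprimep_sym.
Qed.

(** The companion of the previous lemma at the other end of the homogenized
equation: every term of positive index is divisible by f. *)
Lemma dvdp_const_rational_root (F : fieldType) (f g : {poly F})
    (B : {poly {poly F}}) :
  g != 0 -> coprimep f g ->
  root (map_poly tofrac B) (tofrac f / tofrac g) -> f %| B`_0.
Proof.
move=> g0 cofg /(homogenized_root (leqnSn _) g0).
rewrite big_ord_recl /= mulr1 => /eqP; rewrite addr_eq0 => /eqP E.
rewrite -(Gauss_dvdpl _ (coprimep_expr (size B - 0) cofg)) E dvdpNr.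
elim/big_ind: _ => [|p q|j _]; rewrite ?dvdp0 //; first exact: dvdp_add.
by rewrite dvdp_mulr // dvdp_mull // dvdp_exp.
Qed.

(** Here g divides the leading coefficient of B, and f, unless it is 0, divides
the lowest nonzero one, which is the constant coefficient once a power of the
variable has been divided out. *)
Lemma size_rational_root (F : fieldType) (f g : {poly F}) (B : {poly {poly F}}) :
  g != 0 -> coprimep f g -> B != 0 ->
  root (map_poly tofrac B) (tofrac f / tofrac g) ->
  (maxn (size f) (size g) <= sizeY B)%N.
Proof.
move=> g0 cofg B0 Broot; rewrite geq_max; apply/andP; split; last first.
  apply: leq_trans (max_size_coefXY B (size B).-1).
  apply: dvdp_leq; first by rewrite lead_coef_eq0.
  exact: dvdp_lead_rational_root cofg Broot.
have [->|f0] := eqVneq f 0; first by rewrite size_poly0.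
have [m [Q]] := multiplicity_XsubC B 0.
rewrite B0 /root horner_coef0 subr0 => /= Q0 BQ.
have QB : Q`_0 = B`_m by rewrite BQ coefMXn ltnn subnn.
apply: leq_trans (max_size_coefXY B m); rewrite -QB.
apply: (dvdp_leq Q0); apply: (dvdp_const_rational_root g0 cofg).
move: Broot; rewrite BQ rmorphM /= map_polyXn rootM rootE.
case/orP => [Qroot|/rootP/eqP]; first exact: Qroot.
rewrite hornerXn expf_eq0 mulf_eq0 invr_eq0.
by rewrite !tofrac_eq0 (negPf f0) (negPf g0) andbF.
Qed.

(** An equation over F has constant coefficients, so a rational root f/g would
have f and g constant. *)
Lemma frac_transc (F : fieldType) (f g : {poly F}) :
  g != 0 -> coprimep f g -> (1 < maxn (size f) (size g))%N ->
  ~ algebraicOver (@ratfunC F) (tofrac f / tofrac g).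
Proof.
move=> g0 cofg max1 [p p0 proot]; move: max1; rewrite ltnNge => /negP; apply.
apply: leq_trans (size_rational_root g0 cofg (_ : p^:P != 0) _) _.
- by rewrite map_polyC_eq0.
- by rewrite -map_poly_comp.
by rewrite sizeYE swapXY_map_polyC size_polyC; case: (p == 0).
Qed.

(** * The polynomial f(T) - x g(T) *)

(** The coefficient is a polynomial of degree at most one in x with
coefficients f`_k and - g`_k, so there is no cancellation. *)
Lemma coef_generic_poly (F : fieldType) (f g : {poly F}) k :
  ((generic_poly f g)`_k == 0) = (f`_k == 0) && (g`_k == 0).
Proof.
have -> : (generic_poly f g)`_k = tofrac ((f`_k)%:P - 'X * (g`_k)%:P).
  by rewrite coefB coefZ !coef_map /= rmorphB rmorphM.
rewrite tofrac_eq0.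
apply/eqP/andP => [E|[/eqP-> /eqP->]]; last by rewrite mulr0 subrr.
have /= := congr1 (coefp 0) E; have /= := congr1 (coefp 1) E.
rewrite !coefB !coefXM !coefC /= subr0 sub0r => /eqP; rewrite oppr_eq0.
by move=> -> ->.
Qed.

Lemma size_generic_poly (F : fieldType) (f g : {poly F}) :
  size (generic_poly f g) = maxn (size f) (size g).
Proof.
apply/eqP; rewrite eqn_leq geq_max; apply/and3P; split.
- apply/leq_sizeP => k; rewrite geq_max => /andP[fk gk]; apply/eqP.
  by rewrite coef_generic_poly !nth_default ?eqxx.
- apply/leq_sizeP => k /leq_sizeP/(_ k (leqnn k))/eqP.
  by rewrite coef_generic_poly => /andP[/eqP].
- apply/leq_sizeP => k /leq_sizeP/(_ k (leqnn k))/eqP.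
  by rewrite coef_generic_poly => /andP[_ /eqP].
Qed.

Lemma clear_denominators (F : fieldType) (R : {poly ratfun F}) :
  exists d : {poly F}, d != 0 /\
    exists H : {poly {poly F}}, tofrac d *: R = map_poly tofrac H.
Proof.
elim/poly_ind: R => [|R c [d [d0 [H HR]]]].
  by exists 1; rewrite oner_eq0; split=> //; exists 0; rewrite scaler0 rmorph0.
have [n [m m0 ->]] := ratfun_fracP c.
exists (d * m); rewrite mulf_neq0 //; split=> //.
exists (m%:P * H * 'X + (n * d)%:P).
have -> : map_poly tofrac (m%:P * H * 'X + (n * d)%:P)
    = (tofrac m)%:P * map_poly tofrac H * 'X + (tofrac (n * d))%:P.
  by rewrite rmorphD /= map_polyC rmorphM /= map_polyX rmorphM /= map_polyC.
rewrite -HR scalerDr scalerAl mul_polyC scalerA -tofracM (mulrC m); congr (_ + _).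
rewrite -mul_polyC -polyCM; congr (_%:P).
by rewrite mulrC !tofracM mulrA mulrAC mulfVK ?tofrac_eq0.
Qed.

(** Evaluating the coefficients at b and then the polynomial at a is an
evaluation in two variables, to which the exchange of variables applies. *)
Lemma horner_map_horner (F E : fieldType) (i : {rmorphism F -> E})
    (H : {poly {poly F}}) (a b : E) :
  (map_poly (fun p => (map_poly i p).[b]) H).[a] = (map_poly (map_poly i) H).[a, b].
Proof.
have {1}<- : horner_eval b a%:P = a by rewrite /horner_eval hornerC.
rewrite -[RHS]/(horner_eval b _) -horner_map; congr (_.[_]).
by rewrite -map_poly_comp.
Qed.

(** In this section sigma is the substitution of f/g for x. *)
Section SubstX.
Variables (F : fieldType) (f g : {poly F}).
Hypotheses (g0 : g != 0) (cofg : coprimep f g).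
Variable sigma : {rmorphism ratfun F -> ratfun F}.
Hypothesis sigmaC : sigma \o @ratfunC F =1 @ratfunC F.
Hypothesis sigmaX : sigma (ratfunX F) = tofrac f / tofrac g.

Lemma generic_poly_rootX :
  root (map_poly sigma (generic_poly f g)) (ratfunX F).
Proof.
apply/rootP; rewrite rmorphB /= !map_polyZ /= -!map_poly_comp !(eq_map_poly sigmaC).
rewrite hornerD hornerN hornerZ sigmaX -!/(poly_at _ _) -!tofrac_poly_at.
by rewrite divfK ?subrr ?tofrac_eq0.
Qed.

(** In other words, x has degree at least deg P over F(f/g). *)
Lemma generic_poly_min (R : {poly ratfun F}) : R != 0 ->
  root (map_poly sigma R) (ratfunX F) ->
  (size (generic_poly f g) <= size R)%N.
Proof.
move=> R0 Rroot; rewrite size_generic_poly.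
have [d [d0 [H HR]]] := clear_denominators R.
have szH : size H = size R.
  rewrite -(size_map_inj_poly (f := tofrac)) ?tofrac0 //; last first.
    by move=> p q /eqP; rewrite tofrac_eq => /eqP.
  by rewrite -HR size_scale ?tofrac_eq0.
have H0 : H != 0 by rewrite -size_poly_eq0 szH size_poly_eq0.
rewrite -szH -[H]swapXYK -sizeYE.
apply: (size_rational_root g0 cofg); first by rewrite swapXY_eq0.
(* H is a polynomial in T over F[x]; its value at x = phi, T = x vanishes.
   Exchanging the variables turns this into phi being a root of a polynomial
   over F[x] whose coefficients have size at most the size of R. *)
pose at_phi (p : {poly F}) := (map_poly (@ratfunC F) p).[sigma (ratfunX F)].
have Hroot : (map_poly at_phi H).[ratfunX F] = 0.
  have <- : map_poly (sigma \o tofrac) H = map_poly at_phi H.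
    apply: eq_map_poly => p; rewrite /at_phi /= rmorph_tofrac.
    by rewrite (eq_map_poly sigmaC).
  by rewrite map_poly_comp -HR map_polyZ hornerZ (rootP Rroot) mulr0.
rewrite rootE -sigmaX; apply/eqP; rewrite -Hroot horner_map_horner -horner2_swapXY.
rewrite swapXY_map -horner_map_horner.
by congr (_.[_]); apply: eq_map_poly => p; rewrite tofrac_poly_at.
Qed.

End SubstX.

(** * The action of PGL(2, F) on F(x) *)

Section PGLAction.
Variable F : fieldType.
Implicit Types (A B : GL2 F) (s t : PGL2 F).

Lemma det2 (M : 'M[F]_2) : \det M = M 0 0 * M 1 1 - M 0 1 * M 1 0.
Proof.
rewrite (expand_det_row _ 0) !big_ord_recl big_ord0 addr0 /cofactor !det_mx11.
rewrite !mxE /= expr0 expr1 mul1r mulN1r mulrN.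
by congr (_ * M _ _ - M _ _ * M _ _); apply: val_inj.
Qed.

Definition lin_num (M : 'M[F]_2) : {poly F} := M 0 0 *: 'X + (M 0 1)%:P.
Definition lin_den (M : 'M[F]_2) : {poly F} := M 1 0 *: 'X + (M 1 1)%:P.

Lemma lin_fracE M : lin_frac M = tofrac (lin_num M) / tofrac (lin_den M).
Proof. by rewrite /lin_frac /lin_num /lin_den -!mul_polyC !rmorphD !rmorphM. Qed.

Lemma lin_den_neq0 A : lin_den (val A) != 0.
Proof.
apply: contraTneq (valP A) => den0.
have /= := congr1 (coefp 0) den0; have /= := congr1 (coefp 1) den0.
rewrite /lin_den !coefD !coefZ !coefX !coefC /= mulr1 mulr0 addr0 add0r => c0 d0.
by rewrite unitmxE det2 c0 d0 !mulr0 subr0 unitr0.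
Qed.

(** Eliminating the variable between numerator and denominator leaves the
determinant, a nonzero constant. *)
Lemma coprimep_lin A : coprimep (lin_num (val A)) (lin_den (val A)).
Proof.
apply/Bezout_coprimepP.
set M := val A; exists ((M 1 0)%:P, - (M 0 0)%:P); rewrite /= /lin_num /lin_den.
have -> : (M 1 0)%:P * (M 0 0 *: 'X + (M 0 1)%:P)
    + - (M 0 0)%:P * (M 1 0 *: 'X + (M 1 1)%:P) = (- \det M)%:P.
  rewrite det2 -!mul_polyC opprB polyCB !polyCM.
  by ring.
by rewrite polyC_eqp1 oppr_eq0 -unitfE -unitmxE; exact: valP.
Qed.

Lemma lin_frac_transc A : ~ algebraicOver (@ratfunC F) (lin_frac (val A)).
Proof.
rewrite lin_fracE; apply: frac_transc (lin_den_neq0 A) (coprimep_lin A) _.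
rewrite ltnNge geq_max; apply/negP => /andP[n1 d1].
have := valP A; rewrite unitmxE det2.
have /= := leq_sizeP _ _ n1 1%N isT; have /= := leq_sizeP _ _ d1 1%N isT.
rewrite /lin_num /lin_den !coefD !coefZ !coefX !coefC /= !mulr1 !addr0 => -> ->.
by rewrite mul0r mulr0 subr0 unitr0.
Qed.

(* pgl_act s unfolds to the substitution of the transcendental lin_frac. *)
HB.instance Definition _ s := GRing.RMorphism.copy (pgl_act s)
  (ratfun_subst (lin_frac_transc (A := repr s))).

Lemma pgl_actC s c : pgl_act s (ratfunC c) = ratfunC c.
Proof. exact: (ratfun_substC (lin_frac_transc (A := repr s))). Qed.

Lemma pgl_actX A : pgl_act (\pi A)%qT (ratfunX F) = lin_frac (val A).
Proof. by rewrite pgl_act_pi; apply: (ratfun_substX (lin_frac_transc (A := A))). Qed.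

(** Numerator and denominator of a composite of linear fractional
transformations are those of the matrix product, up to the common factor
lin_den B. *)
Lemma lin_fracM A B :
  lin_frac (val (GL2_mul A B)) = pgl_act (\pi B)%qT (lin_frac (val A)).
Proof.
rewrite [in RHS]/lin_frac fmorph_div !rmorphD !rmorphM /= !pgl_actC pgl_actX.
have mx2E i j : (val A *m val B) i j
    = val A i 0 * val B 0 j + val A i 1 * val B 1 j.
  rewrite mxE !big_ord_recl big_ord0 addr0.
  by congr (_ + val A _ _ * val B _ _); apply: val_inj.
have m0 : tofrac (lin_den (val B)) != 0 by rewrite tofrac_eq0 lin_den_neq0.
set m := tofrac (lin_den (val B)).
have lin_row i :
    ratfunC ((val A *m val B) i 0) * ratfunX F + ratfunC ((val A *m val B) i 1)
    = (ratfunC (val A i 0) * lin_frac (val B) + ratfunC (val A i 1)) * m.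
  rewrite lin_fracE mulrDl mulrA divfK // /m /lin_num /lin_den -!mul_polyC.
  rewrite !mx2E !rmorphD !rmorphM /=.
  by rewrite /ratfunC /ratfunX /=; ring.
by rewrite /lin_frac !lin_row -mulf_div divff ?mulr1.
Qed.

(** The order of composition is reversed, as for products of automorphisms in
'Gal(_ / _), so the identification of the Galois group with G preserves products
instead of reversing them. *)
Lemma pgl_actM s t r : pgl_act (s * t)%g r = pgl_act t (pgl_act s r).
Proof.
move: r; apply: (eq_ratfun_rmorph (u := pgl_act (s * t)%g)
  (v := pgl_act t \o pgl_act s)).
  by move=> c /=; rewrite !pgl_actC.
elim/quotW: s => A; elim/quotW: t => B /=.
by rewrite /mulg /= -pi_PGL2_mul !pgl_actX lin_fracM.
Qed.

Lemma pgl_act1 r : pgl_act (1 : PGL2 F)%g r = r.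
Proof.
move: r; apply: (eq_ratfun_rmorph (u := pgl_act 1%g) (v := idfun)).
  by move=> c; exact: pgl_actC.
rewrite /oneg /= pgl_actX /lin_frac /= !mxE /= !rmorph1 !rmorph0.
by rewrite mul1r mul0r addr0 add0r divr1.
Qed.

(** If (a x + b) / (c x + d) = x then a x + b = c x^2 + d x, so the matrix is
scalar. *)
Lemma pgl_act_fixX s : pgl_act s (ratfunX F) = ratfunX F -> s = 1%g.
Proof.
elim/quotW: s => A; rewrite pgl_actX lin_fracE.
have d0 : tofrac (lin_den (val A)) != 0 by rewrite tofrac_eq0 lin_den_neq0.
move/(canRL (divfK d0)); rewrite /ratfunX -tofracM => /eqP; rewrite tofrac_eq.
move=> /eqP E; apply/eqmodP/is_scalar_mxP => /=.
exists (val A 0 0); rewrite invmx1 mulmx1.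
have /= := congr1 (coefp 0) E; have /= := congr1 (coefp 1) E.
have /= := congr1 (coefp 2) E.
rewrite /lin_num /lin_den !coefXM !coefD !coefZ !coefX !coefC /=.
rewrite !mulr0 !mulr1 !addr0 !add0r => c0 ad b0.
apply/matrixP => i j; rewrite !mxE.
have I2 (k : 'I_2) : k = 0 \/ k = 1.
  by case: k => [[|[|//]] ?]; [left | right]; apply: val_inj.
by case: (I2 i) => ->; case: (I2 j) => ->; rewrite ?mulr0n ?mulr1n.
Qed.

Lemma pgl_actX_inj : injective (fun s => pgl_act s (ratfunX F)).
Proof.
move=> s t est; apply: divg1_eq; apply: pgl_act_fixX.
by rewrite pgl_actM est -pgl_actM mulgV pgl_act1.
Qed.

End PGLAction.

(** * The orbit of x and the degree *)

Lemma poly_preimage (U V : nzRingType) (u : {additive U -> V}) (Q : {poly V}) :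
  (forall k, exists y, u y = Q`_k) -> exists Q0, map_poly u Q0 = Q.
Proof.
elim/poly_ind: Q => [|Q c IH] Qu; first by exists 0; rewrite map_poly0.
have [k|Q0 uQ0] := IH.
  by have := Qu k.+1; rewrite coefD coefMX coefC addr0.
have := Qu 0%N; rewrite coefD coefMX coefC add0r => -[y uy].
exists (Q0 * 'X + y%:P); apply/polyP => k.
rewrite coef_map coefD coefMX coefC [in RHS]coefD coefMX coefC -uQ0.
by case: k => [|k] /=; rewrite ?add0r ?addr0 // coef_map.
Qed.

Section OrbitPoly.
Variables (F : fieldType) (G : {fset PGL2 F}).
Hypothesis hG : group_closed [pred s in G].

Definition orbitX : seq (ratfun F) := [seq pgl_act s (ratfunX F) | s <- G].
Definition orbit_poly : {poly ratfun F} := \prod_(r <- orbitX) ('X - r%:P).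

Lemma mem_orbitX r :
  reflect (exists2 s, s \in G & r = pgl_act s (ratfunX F)) (r \in orbitX).
Proof. exact: mapP. Qed.

Lemma uniq_orbitX : uniq orbitX.
Proof. by rewrite map_inj_uniq ?fset_uniq //; exact: pgl_actX_inj. Qed.

Lemma size_orbitX : size orbitX = #|` G|.
Proof. by rewrite size_map. Qed.

Lemma mem_orbitX_X : ratfunX F \in orbitX.
Proof. by apply/mem_orbitX; exists 1%g; [exact: hG.1 | rewrite pgl_act1]. Qed.

Lemma orbitX_act t : t \in G -> perm_eq (map (pgl_act t) orbitX) orbitX.
Proof.
have uniqG := uniq_orbitX; move=> Gt; apply: uniq_perm => //.
  by rewrite map_inj_uniq //; exact: fmorph_inj.
have GM s u : s \in G -> u \in G -> (s * u)%g \in G.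
  by move=> Gs Gu; apply: (group_closedM hG).
have GB s : s \in G -> (s * t^-1)%g \in G by move=> Gs; apply: (hG.2 s t).
move=> r; apply/mapP/mem_orbitX => [[_ /mem_orbitX[s Gs ->] ->]|[s Gs ->]].
  by exists (s * t)%g; [exact: GM | rewrite pgl_actM].
exists (pgl_act (s * t^-1)%g (ratfunX F)).
  by apply/mem_orbitX; exists (s * t^-1)%g => //; exact: GB.
by rewrite -pgl_actM mulgKV.
Qed.

(** Acting by t in G only permutes the factors. *)
Lemma orbit_poly_invariant k : Defs.invariant G orbit_poly`_k.
Proof.
move=> t Gt; rewrite -coef_map.
suff -> : map_poly (pgl_act t) orbit_poly = orbit_poly by [].
rewrite /orbit_poly rmorph_prod /= -[RHS](perm_big _ (orbitX_act Gt)) !big_map.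
by apply: eq_bigr => r _; rewrite rmorphB /= map_polyX map_polyC.
Qed.

End OrbitPoly.

Section Generator.
Variables (F : fieldType) (G : {fset PGL2 F}).
Hypothesis hG : group_closed [pred s in G].
Variables (f g : {poly F}).
Hypotheses (g0 : g != 0) (cofg : coprimep f g).
Local Notation phi := (tofrac f / tofrac g).
Hypothesis hgen : is_generator G phi.

Lemma phi_invariant : Defs.invariant G phi.
Proof.
apply/hgen; exists 'X, 1; rewrite /poly_at map_polyX rmorph1 hornerX hornerC.
by rewrite oner_eq0 divr1.
Qed.

Lemma orbit_poly_preimage (E : nzRingType) (u : {additive E -> ratfun F}) :
  (forall r, in_adjoin phi r -> exists y, u y = r) ->
  exists Q0, map_poly u Q0 = orbit_poly G.
Proof.
move=> uE; apply: poly_preimage => k; apply/uE/hgen.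
exact: orbit_poly_invariant.
Qed.

Lemma orbit_poly_rootX : root (orbit_poly G) (ratfunX F).
Proof. by rewrite root_prod_XsubC mem_orbitX_X. Qed.

Lemma orbit_poly_neq0 : orbit_poly G != 0.
Proof. by rewrite monic_neq0 ?monic_prod_XsubC. Qed.

(** Otherwise F(phi) = F, the orbit polynomial has constant coefficients, and x
is algebraic over F. *)
Lemma generator_nonconstant : (1 < maxn (size f) (size g))%N.
Proof.
rewrite ltnNge geq_max; apply/negP => /andP[/size1_polyC fC /size1_polyC gC].
have phiC : phi = ratfunC (f`_0 / g`_0) by rewrite [in LHS]fC [in LHS]gC fmorph_div.
have atC p c : poly_at p (ratfunC c) = ratfunC p.[c] by rewrite /poly_at horner_map.
have [_ [p [q [_ ->]]]|q qQ] := orbit_poly_preimage (u := @ratfunC F).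
  rewrite phiC !atC; exists (p.[f`_0 / g`_0] / q.[f`_0 / g`_0]).
  by rewrite /= fmorph_div.
have /rootP := orbit_poly_rootX; rewrite -qQ -/(poly_at _ _) -tofrac_poly_at.
move/eqP; rewrite tofrac_eq0 => q0; have := orbit_poly_neq0.
by rewrite -qQ (eqP q0) rmorph0 eqxx.
Qed.

Lemma generator_subst : exists2 sigma : {rmorphism ratfun F -> ratfun F},
  sigma \o @ratfunC F =1 @ratfunC F & sigma (ratfunX F) = phi.
Proof.
exact/ratfun_rmorph_exists/(frac_transc g0 cofg)/generator_nonconstant.
Qed.

Variable sigma : {rmorphism ratfun F -> ratfun F}.
Hypothesis sigmaC : sigma \o @ratfunC F =1 @ratfunC F.
Hypothesis sigmaX : sigma (ratfunX F) = phi.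

Local Notation P := (generic_poly f g).

Lemma in_adjoin_sigma r : in_adjoin phi r -> exists y, sigma y = r.
Proof.
have sigma_tofrac p : sigma (tofrac p) = poly_at p phi.
  by rewrite (rmorph_tofrac sigma) (eq_map_poly sigmaC) sigmaX.
move=> [p [q [_ ->]]]; exists (tofrac p / tofrac q).
by rewrite (fmorph_div sigma) !sigma_tofrac.
Qed.

Lemma orbit_poly_sigma : exists Q0, map_poly sigma Q0 = orbit_poly G.
Proof. exact: orbit_poly_preimage in_adjoin_sigma. Qed.

Lemma generic_poly_neq0 : P != 0.
Proof.
by rewrite -size_poly_gt0 size_generic_poly ltnW ?generator_nonconstant.
Qed.

(** x is a root, and the coefficients are fixed by G because phi is. *)
Lemma orbitX_roots : all (root (map_poly sigma P)) (orbitX G).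
Proof.
apply/allP => _ /mem_orbitX[s Gs ->].
have -> : map_poly sigma P = map_poly (pgl_act s) (map_poly sigma P).
  rewrite -map_poly_comp /generic_poly !rmorphB /= !map_polyZ /= -!map_poly_comp.
  rewrite /= sigmaX phi_invariant //.
  have sC : pgl_act s \o sigma \o @ratfunC F =1 @ratfunC F.
    by move=> c; rewrite -[RHS](pgl_actC s c) -[in RHS]sigmaC.
  by rewrite !(eq_map_poly sigmaC) !(eq_map_poly sC).
by rewrite fmorph_root (generic_poly_rootX g0 sigmaC sigmaX).
Qed.

Lemma size_generic_poly_card : size P = #|` G|.+1.
Proof.
apply/eqP; rewrite eqn_leq; apply/andP; split.
  have [Q0 Q0Q] := orbit_poly_sigma.
  have -> : #|` G|.+1 = size Q0.
    by rewrite -(size_map_poly sigma) Q0Q size_prod_XsubC size_orbitX.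
  apply: (generic_poly_min g0 cofg sigmaC sigmaX).
    by rewrite -(map_poly_eq0 sigma) Q0Q orbit_poly_neq0.
  by rewrite Q0Q orbit_poly_rootX.
rewrite -size_orbitX -(size_map_poly sigma P).
apply: max_poly_roots orbitX_roots (uniq_orbitX G).
by rewrite map_poly_eq0 generic_poly_neq0.
Qed.

Lemma generic_poly_factor :
  map_poly sigma P = lead_coef (map_poly sigma P) *: orbit_poly G.
Proof.
apply: all_roots_prod_XsubC orbitX_roots _; last by rewrite uniq_rootsE uniq_orbitX.
by rewrite size_map_poly size_generic_poly_card size_orbitX.
Qed.

(** The remainder of R modulo P vanishes at x too, and it is smaller than P. *)
Lemma generic_poly_dvdp (R : {poly ratfun F}) :
  P %| R = root (map_poly sigma R) (ratfunX F).
Proof.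
have Proot := generic_poly_rootX g0 sigmaC sigmaX.
apply/idP/idP => [/dvdpP[h ->]|Rroot]; first by rewrite rmorphM rootM Proot orbT.
have rem_root : root (map_poly sigma (R %% P)) (ratfunX F).
  move: Rroot; rewrite [in X in X -> _](divp_eq R P) rmorphD rmorphM /= !rootE.
  by rewrite hornerD hornerM (rootP Proot) mulr0 add0r.
apply/modp_eq0P/eqP; apply: contraT => nPR; have := ltn_modp R P.
rewrite generic_poly_neq0 ltnNge.
by rewrite (generic_poly_min g0 cofg sigmaC sigmaX nPR rem_root).
Qed.

(** In a factorization of P one factor vanishes at x after sigma, so P divides
it; comparing sizes, the other factor is constant. *)
Lemma generic_poly_irreducible : irreducible_poly P.
Proof.
have sz : (1 < size P)%N by rewrite size_generic_poly generator_nonconstant.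
split=> // q q1 qP; have /dvdpP[h Phq] := qP.
have : root (map_poly sigma P) (ratfunX F) by rewrite -generic_poly_dvdp.
have [h0 q0] : h != 0 /\ q != 0.
  by apply/andP; rewrite -negb_or -mulf_eq0 -Phq generic_poly_neq0.
rewrite {1}Phq rmorphM rootM -!generic_poly_dvdp => /orP[Ph|Pq]; last first.
  by rewrite /eqp qP.
have szq : (1 < size q)%N by rewrite ltn_neqAle eq_sym q1 size_poly_gt0.
have := dvdp_leq h0 Ph; rewrite Phq size_mul // -(subnK szq) addn2 addnS /=.
by rewrite addnS leqNgt ltnS leq_addr.
Qed.

(** * Extensions of F(x) containing a root *)

Section RootField.
Variables (L : fieldExtType (ratfun F)) (z : L).
Hypothesis Pz : root (map_poly (in_alg L) P) z.

(** Both sides say that P divides R.  This is the isomorphism over F(x) between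
F(x)(z) and F(x) viewed as an extension of itself through sigma. *)
Lemma root_generic_poly (R : {poly ratfun F}) :
  root (map_poly (in_alg L) R) z = root (map_poly sigma R) (ratfunX F).
Proof.
rewrite -generic_poly_dvdp.
apply/idP/idP => [Rz|/dvdpP[h ->]]; last by rewrite rmorphM rootM Pz orbT.
have Pirr := generic_poly_irreducible.
apply: contraTT Rz => nPR.
by rewrite rootE (coprimep_root _ Pz) // coprimep_map irreducible_poly_coprime.
Qed.

Lemma root_field_transc : ~ algebraicOver (in_alg L \o @ratfunC F) z.
Proof.
case=> p p0; rewrite map_poly_comp root_generic_poly -map_poly_comp.
rewrite (eq_map_poly sigmaC) rootE -/(poly_at _ _) -tofrac_poly_at.
by rewrite tofrac_eq0 (negPf p0).
Qed.

(** tau is evaluation at z.  The two morphisms agree on x because P(z) = 0 says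
exactly that f(z) / g(z) = x. *)
Lemma root_field_subst : exists2 tau : {rmorphism ratfun F -> L},
  tau (ratfunX F) = z & tau \o sigma =1 in_alg L.
Proof.
have [tau tauC tauX] := ratfun_rmorph_exists root_field_transc.
exists tau => //; apply: (eq_ratfun_rmorph (u := tau \o sigma) (v := in_alg L)).
  by move=> c; rewrite -[RHS]tauC; congr (tau _); exact: sigmaC.
have tau_poly p : tau (tofrac p) = (map_poly (in_alg L \o @ratfunC F) p).[z].
  by rewrite (rmorph_tofrac tau) tauX (eq_map_poly tauC).
have tg0 : tau (tofrac g) != 0 by rewrite fmorph_eq0 tofrac_eq0.
rewrite /= sigmaX (fmorph_div tau); apply: (canLR (mulfK tg0)).
apply/eqP; rewrite -subr_eq0 !tau_poly.
move: Pz; rewrite rootE rmorphB /= map_polyZ -!map_poly_comp.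
by rewrite hornerD hornerN hornerZ.
Qed.

Variable tau : {rmorphism ratfun F -> L}.
Hypothesis tauX : tau (ratfunX F) = z.
Hypothesis tau_sigma : tau \o sigma =1 in_alg L.

Lemma tau_horner (R : {poly ratfun F}) :
  (map_poly (in_alg L) R).[z] = tau (map_poly sigma R).[ratfunX F].
Proof. by rewrite -(eq_map_poly tau_sigma) map_poly_comp -tauX horner_map. Qed.

Lemma tau_ratfunC : tau \o @ratfunC F =1 in_alg L \o @ratfunC F.
Proof. by move=> c /=; rewrite -[RHS]tau_sigma -[in LHS]sigmaC. Qed.

(** The image under tau of the factorization of sigma(P) inside F(x). *)
Lemma generic_poly_split :
  map_poly (in_alg L) P %= \prod_(y <- map tau (orbitX G)) ('X - y%:P).
Proof.
rewrite -(eq_map_poly tau_sigma) map_poly_comp.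
rewrite generic_poly_factor map_polyZ.
have c0 : tau (lead_coef (map_poly sigma P)) != 0.
  by rewrite fmorph_eq0 lead_coef_eq0 map_poly_eq0 generic_poly_neq0.
apply: eqp_trans (eqp_scale _ c0) _.
rewrite rmorph_prod big_map (eq_bigr (fun r => 'X - (tau r)%:P)) ?eqpxx //.
by move=> r _; rewrite rmorphB /= map_polyX map_polyC.
Qed.

Lemma root_generic_polyE y :
  root (map_poly (in_alg L) P) y = (y \in map tau (orbitX G)).
Proof. by rewrite (eqp_root generic_poly_split) root_prod_XsubC. Qed.

Lemma tau_Fadjoin r : tau r \in <<1; z>>%VS.
Proof.
have tau_poly p : tau (tofrac p) \in <<1; z>>%VS.
  rewrite (rmorph_tofrac tau) tauX (eq_map_poly tau_ratfunC) map_poly_comp.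
  by apply: mempx_Fadjoin; apply/polyOver1P; eexists.
have [n [d _ ->]] := ratfun_fracP r.
by rewrite (fmorph_div tau) rpred_div.
Qed.

Lemma Fadjoin_tau v : v \in <<1; z>>%VS -> exists r, v = tau r.
Proof.
case/Fadjoin_polyP => _ /polyOver1P[R ->] ->.
by rewrite tau_horner; eexists.
Qed.

Lemma mem_z_orbit : z \in map tau (orbitX G).
Proof. by rewrite -tauX map_f // mem_orbitX_X. Qed.

End RootField.

(** * The Galois group *)

(** Adjoining a single root of the irreducible P already splits it. *)
Lemma splitting_field_exists : exists L : splittingFieldType (ratfun F),
  splittingFieldFor 1 (map_poly (in_alg L) P) {:L}.
Proof.
have Pirr := generic_poly_irreducible.
have [L _ [z Pz genz]] := irredp_FAdjoin Pirr.
have [tau tauX tau_sigma] := root_field_subst Pz.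
have splitL : splittingFieldFor 1 (map_poly (in_alg L) P) {:L}.
  exists (map tau (orbitX G)).
    exact: (generic_poly_split tau_sigma).
  apply/eqP; rewrite eqEsubv subvf -genz; apply/FadjoinP; split.
    exact: subv_adjoin_seq.
  by apply: seqv_sub_adjoin; exact: mem_z_orbit.
have splitA : splitting_field_axiom L.
  by exists (map_poly (in_alg L) P); [apply/polyOver1P; exists P | ].
pose M := FieldExt_isSplittingField.Build _ L splitA.
pose L' : splittingFieldType (ratfun F) := HB.pack (FieldExt.sort L) M.
by exists L'.
Qed.

Section SplittingField.
Variable L : splittingFieldType (ratfun F).
Hypothesis splitL : splittingFieldFor 1 (map_poly (in_alg L) P) {:L}.

Lemma splitting_field_root : exists2 z : L,
  root (map_poly (in_alg L) P) z & <<1; z>>%VS = fullv.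
Proof.
have [rs Prs genL] := splitL.
have : (1 < size (map_poly (in_alg L) P))%N.
  by rewrite size_map_poly size_generic_poly generator_nonconstant.
case: rs => [|z rs] in Prs genL *.
  by rewrite (eqp_size Prs) big_nil size_poly1.
have Pz : root (map_poly (in_alg L) P) z.
  by rewrite (eqp_root Prs) root_prod_XsubC mem_head.
exists z => //; have [tau tauX tau_sigma] := root_field_subst Pz.
apply/eqP; rewrite eqEsubv subvf -genL; apply/Fadjoin_seqP; split.
  exact: subv_adjoin.
move=> y; rewrite -root_prod_XsubC -(eqp_root Prs).
rewrite (root_generic_polyE tau_sigma).
by case/mapP=> r _ ->; exact: (tau_Fadjoin tauX tau_sigma).
Qed.

Lemma splitting_field_galois : galois 1 {:L}.
Proof.
have [z Pz genz] := splitting_field_root.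
have [tau tauX tau_sigma] := root_field_subst Pz.
apply/splitting_galoisField; exists (map_poly (in_alg L) P); split=> //.
  by apply/polyOver1P; exists P.
rewrite (eqp_separable (generic_poly_split tau_sigma)).
by rewrite separable_prod_XsubC map_inj_uniq ?uniq_orbitX //; exact: fmorph_inj.
Qed.

(** The isomorphism psi sends h to the s in G with h(z) = tau(s(x)).  The key
relation is psi_tau, h o tau = tau o (action of psi h): it gives
multiplicativity, and injectivity since tau is onto L. *)
Lemma splitting_field_isog : isog_fset 'Gal({:L} / 1) G.
Proof.
have [z Pz genz] := splitting_field_root.
have [tau tauX tau_sigma] := root_field_subst Pz.
have gal_alg (h : gal_of {:L}) : h \o in_alg L =1 in_alg L.
  by move=> a; exact: rmorph_alg.
have galP (h : gal_of {:L}) (y : L) :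
    root (map_poly (in_alg L) P) y -> root (map_poly (in_alg L) P) (h y).
  by rewrite -(fmorph_root h) -map_poly_comp (eq_map_poly (gal_alg h)).
have gal_orbit (h : gal_of {:L}) :
    exists s, (s \in G) && (h z == tau (pgl_act s (ratfunX F))).
  have := galP h z Pz.
  rewrite (root_generic_polyE tau_sigma).
  by case/mapP=> _ /mem_orbitX[s Gs ->] ->; exists s; rewrite Gs eqxx.
pose psi h := xchoose (gal_orbit h).
have psiG h : psi h \in G by case/andP: (xchooseP (gal_orbit h)).
have psi_z (h : gal_of {:L}) : h z = tau (pgl_act (psi h) (ratfunX F)).
  by case/andP: (xchooseP (gal_orbit h)) => _ /eqP.
have psi_uniq (h : gal_of {:L}) s : h z = tau (pgl_act s (ratfunX F)) -> psi h = s.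
  by rewrite psi_z => /fmorph_inj/pgl_actX_inj.
have psi_tau (h : gal_of {:L}) r : h (tau r) = tau (pgl_act (psi h) r).
  move: r; apply: (eq_ratfun_rmorph (u := h \o tau) (v := tau \o pgl_act (psi h))).
    move=> c; rewrite /= pgl_actC.
    have tauc := tau_ratfunC tau_sigma c.
    by rewrite /= in tauc; rewrite tauc; exact: gal_alg.
  by rewrite /= tauX psi_z.
exists psi; split.
- move=> h1 h2 _ _; apply: psi_uniq.
  by rewrite galM ?memvf // psi_z psi_tau pgl_actM.
- move=> h1 h2 _ _ eq_psi; apply/eqP/gal_eqP => v _.
  have [r ->] : exists r, v = tau r.
    by apply: (Fadjoin_tau tauX tau_sigma); rewrite genz memvf.
  by rewrite !psi_tau eq_psi.
move=> s; split=> [Gs|[h _ <-]]; last exact: psiG.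
have [_ _ normL] := and3P splitting_field_galois.
have rootb : root (minPoly 1 z) (tau (pgl_act s (ratfunX F))).
  (* The minimal polynomial of z comes from a polynomial R over F(x) that P
     divides, so it vanishes at all roots of P. *)
  have /polyOver1P[R mR] := minPolyOver 1 z.
  have := root_minPoly 1 z; rewrite mR.
  rewrite (root_generic_poly Pz).
  rewrite -generic_poly_dvdp => /dvdpP[q ->].
  rewrite rmorphM rootM.
  rewrite (root_generic_polyE tau_sigma).
  by rewrite (map_f tau (introT (mem_orbitX _ _) (ex_intro2 _ _ s Gs erefl))) orbT.
have [h Gh hz] := normalField_root_minPoly (sub1v _) normL (memvf z) rootb.
by exists h => //; apply: psi_uniq.
Qed.

End SplittingField.
End Generator.

Theorem mainTheorem1 (F : fieldType) (G : {fset PGL2 F})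
    (hG : group_closed [pred s in G])
    (f g : {poly F}) (hg : g != 0) (hfg : coprimep f g)
    (hgen : is_generator G (FracField.tofrac f / FracField.tofrac g)) :
  [/\ irreducible_poly (generic_poly f g),
      size (generic_poly f g) = #|` G|.+1
    & has_galois_group (generic_poly f g) G].
Proof.
have [sigma sigmaC sigmaX] := generator_subst hG hg hfg hgen.
split.
- exact: (generic_poly_irreducible hG hg hfg hgen sigmaC sigmaX).
- exact: (size_generic_poly_card hG hg hfg hgen sigmaC sigmaX).
split; first exact: (splitting_field_exists hG hg hfg hgen sigmaC sigmaX).
move=> L splitL; split.
  exact: (splitting_field_galois hG hg hfg hgen sigmaC sigmaX splitL).
exact: (splitting_field_isog hG hg hfg hgen sigmaC sigmaX splitL).
Qed.
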